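(* $$\int_0^{\infty} e^{-x^2}\sin(x)\,dx = \frac{\sqrt{\pi}}{2}\,e^{-1/4}\,\mathrm{erfi}\!\left(\frac{1}{2}\right).$$
   Context: The imaginary error function is $\mathrm{erfi}(x)=\frac{2}{\sqrt{\pi}}\int_0^x e^{t^2}\,dt$. *)

(* Defs.v *)
From Stdlib Require Import Reals.
From Coquelicot Require Import Coquelicot.
Open Scope R_scope.

Definition erfi (x : R) : R :=
  2 / sqrt PI * RInt (fun t : R => exp (t ^ 2)) 0 x.

(* Main.v *)
(** Let [f u x = exp (u^2 - x^2) sin (2 u x)] and [g u x = - exp (u^2 - x^2) cos (2 u x)].
    Up to sign these are the imaginary and real parts of [exp (- (x - i u)^2)], so
    [df/du = dg/dx] by the Cauchy-Riemann equations.  Hence the integral of [f u] over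
    [[0, R]] has [u]-derivative [g u R - g u 0]; integrating this over [u] in [[0, 1/2]]
    evaluates the truncated integral up to an error of at most [exp (- R^2) / 2]. *)
Require Import Defs.
From Stdlib Require Import Reals Lra.
From Coquelicot Require Import Coquelicot.
Open Scope R_scope.

Lemma is_derive_gauss_sin (u x : R) :
  is_derive (fun u => exp (u ^ 2 - x ^ 2) * sin (2 * u * x)) u
    (exp (u ^ 2 - x ^ 2) * (2 * u * sin (2 * u * x) + 2 * x * cos (2 * u * x))).
Proof. auto_derive; [easy | simpl; unfold Rminus; ring]. Qed.

Lemma is_derive_gauss_cos (u x : R) :
  is_derive (fun x => - (exp (u ^ 2 - x ^ 2) * cos (2 * u * x))) x
    (exp (u ^ 2 - x ^ 2) * (2 * u * sin (2 * u * x) + 2 * x * cos (2 * u * x))).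
Proof. auto_derive; [easy | simpl; unfold Rminus; ring]. Qed.

Lemma continuous_gauss_sin (u x : R) :
  continuous (fun x => exp (u ^ 2 - x ^ 2) * sin (2 * u * x)) x.
Proof. apply (ex_derive_continuous (V := R_NormedModule)); auto_derive; easy. Qed.

(** Joint continuity of the [u]-derivative is what [is_derive_RInt_param] requires for
    differentiating under the integral sign. *)
Lemma continuity_2d_pt_gauss (u x : R) :
  continuity_2d_pt
    (fun u x => exp (u ^ 2 - x ^ 2) * (2 * u * sin (2 * u * x) + 2 * x * cos (2 * u * x))) u x.
Proof.
assert (Hsqr : forall y, continuity_pt (fun z => z ^ 2) y) by (intro; reg).
assert (Hphase : continuity_2d_pt (fun u x => 2 * u * x) u x).
{ repeat apply continuity_2d_pt_mult;
    auto using continuity_2d_pt_const, continuity_2d_pt_id1, continuity_2d_pt_id2. }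
apply continuity_2d_pt_mult.
- apply (continuity_1d_2d_pt_comp exp (fun u x => u ^ 2 - x ^ 2)); [reg |].
  apply continuity_2d_pt_minus.
  + apply (continuity_1d_2d_pt_comp (fun z => z ^ 2) (fun u _ => u));
      [apply Hsqr | apply continuity_2d_pt_id1].
  + apply (continuity_1d_2d_pt_comp (fun z => z ^ 2) (fun _ x => x));
      [apply Hsqr | apply continuity_2d_pt_id2].
- apply continuity_2d_pt_plus; repeat apply continuity_2d_pt_mult;
    auto using continuity_2d_pt_const, continuity_2d_pt_id1, continuity_2d_pt_id2.
  + apply (continuity_1d_2d_pt_comp sin); [reg | exact Hphase].
  + apply (continuity_1d_2d_pt_comp cos); [reg | exact Hphase].
Qed.

Lemma is_derive_RInt_gauss_sin (r u : R) :
  is_derive (fun u => RInt (fun x => exp (u ^ 2 - x ^ 2) * sin (2 * u * x)) 0 r) u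
    (exp (u ^ 2) - exp (u ^ 2 - r ^ 2) * cos (2 * u * r)).
Proof.
evar_last.
- apply is_derive_RInt_param.
  + apply filter_forall; intros v x _; eexists; apply is_derive_gauss_sin.
  + intros x _.
    apply continuity_2d_pt_ext with (2 := continuity_2d_pt_gauss u x).
    intros v y; symmetry; apply is_derive_unique, is_derive_gauss_sin.
  + apply filter_forall; intro v.
    apply (ex_RInt_continuous (V := R_CompleteNormedModule)); intros; apply continuous_gauss_sin.
- apply is_RInt_unique.
  evar_last.
  (* The integrand is a derivative in [u]. Since the two derivative lemmas share their right-hand
     side, it is also the [x]-derivative of the cosine term, so only boundary values remain. *)
  + apply (is_RInt_derive (V := R_CompleteNormedModule)
      (fun x => - (exp (u ^ 2 - x ^ 2) * cos (2 * u * x)))).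
    * intros x _; evar_last; [apply is_derive_gauss_cos |].
      symmetry; apply is_derive_unique, is_derive_gauss_sin.
    * intros x _.
      apply (continuous_ext
        (fun y => exp (u ^ 2 - y ^ 2) * (2 * u * sin (2 * u * y) + 2 * y * cos (2 * u * y)))).
      { intro y; symmetry; apply is_derive_unique, is_derive_gauss_sin. }
      apply (ex_derive_continuous (V := R_NormedModule)); auto_derive; easy.
  + unfold minus, plus, opp; simpl.
    (* The boundary value at [x = 0] leaves [exp (u ^ 2)], the integrand of [erfi]. *)
    replace (2 * u * 0) with 0 by ring; rewrite cos_0.
    replace (u * (u * 1) - 0 * (0 * 1)) with (u * (u * 1)) by ring; ring.
Qed.

Lemma is_RInt_exp_sqr (a b : R) :
  is_RInt (fun t => exp (t ^ 2)) a b (RInt (fun t => exp (t ^ 2)) a b).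
Proof.
apply (RInt_correct (V := R_CompleteNormedModule)).
apply (ex_RInt_continuous (V := R_CompleteNormedModule)); intros x _.
apply (ex_derive_continuous (V := R_NormedModule)); auto_derive; easy.
Qed.

(** Integrate the preceding derivative over [u]; no constant appears, because the sine vanishes at
    [u = 0]. The identity is solved for the cosine integral, which is the remainder to be
    estimated. *)
Lemma is_RInt_gauss_cos (r b : R) :
  is_RInt (fun u => exp (u ^ 2 - r ^ 2) * cos (2 * u * r)) 0 b
    (RInt (fun t => exp (t ^ 2)) 0 b
      - RInt (fun x => exp (b ^ 2 - x ^ 2) * sin (2 * b * x)) 0 r).
Proof.
set (F := fun u => RInt (fun x => exp (u ^ 2 - x ^ 2) * sin (2 * u * x)) 0 r).
assert (F0 : F 0 = 0).
{ unfold F; rewrite (RInt_ext _ (fun _ => 0)).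
  - rewrite RInt_const; apply Rmult_0_r.
  - intros x _; replace (2 * 0 * x) with 0 by ring; rewrite sin_0; apply Rmult_0_r. }
assert (HF : is_RInt (fun u => exp (u ^ 2) - exp (u ^ 2 - r ^ 2) * cos (2 * u * r)) 0 b (F b)).
{ evar_last.
  - apply (is_RInt_derive (V := R_CompleteNormedModule) F).
    + intros u _; apply is_derive_RInt_gauss_sin.
    + intros u _; apply (ex_derive_continuous (V := R_NormedModule)); auto_derive; easy.
  - rewrite F0; unfold minus, plus, opp; simpl; ring. }
apply (is_RInt_ext (fun u => minus (exp (u ^ 2))
  (exp (u ^ 2) - exp (u ^ 2 - r ^ 2) * cos (2 * u * r)))).
{ intros u _; unfold minus, plus, opp; simpl; ring. }
exact (is_RInt_minus _ _ _ _ _ _ (is_RInt_exp_sqr 0 b) HF).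
Qed.

(** At [u = 1 / 2] the phase [2 * u * x] is [x], and the prefactor cancels [exp (u ^ 2)]. *)
Lemma is_RInt_gauss_sin_1 (r : R) :
  is_RInt (fun x => exp (- x ^ 2) * sin x) 0 r
    (exp (- (1 / 4)) * RInt (fun x => exp ((1 / 2) ^ 2 - x ^ 2) * sin (2 * (1 / 2) * x)) 0 r).
Proof.
apply (is_RInt_ext (fun x => scal (exp (- (1 / 4)))
  (exp ((1 / 2) ^ 2 - x ^ 2) * sin (2 * (1 / 2) * x)))).
{ intros x _; unfold scal; simpl; unfold mult; simpl.
  rewrite <- Rmult_assoc, <- exp_plus; f_equal; f_equal; field. }
apply (is_RInt_scal (V := R_NormedModule)), (RInt_correct (V := R_CompleteNormedModule)).
apply (ex_RInt_continuous (V := R_CompleteNormedModule)); intros; apply continuous_gauss_sin.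
Qed.

(** Up to sign, the difference is [exp (- (1 / 4))] times the cosine integral over an interval of
    length 1/2. There [u ^ 2 <= 1 / 4] and the cosine is at most 1 in absolute value, so the
    integrand is bounded by [exp (1 / 4 - r ^ 2)]. *)
Lemma gauss_sin_truncation_error (r : R) :
  Rabs (exp (- (1 / 4)) * RInt (fun x => exp ((1 / 2) ^ 2 - x ^ 2) * sin (2 * (1 / 2) * x)) 0 r
    - exp (- (1 / 4)) * RInt (fun t => exp (t ^ 2)) 0 (1 / 2)) <= exp (- r ^ 2) / 2.
Proof.
rewrite <- Rmult_minus_distr_l, Rabs_mult, Rabs_minus_sym.
rewrite (Rabs_pos_eq (exp _)) by (apply Rlt_le, exp_pos).
assert (H := is_RInt_gauss_cos r (1 / 2)).
assert (Hb : Rabs (RInt (fun t => exp (t ^ 2)) 0 (1 / 2)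
    - RInt (fun x => exp ((1 / 2) ^ 2 - x ^ 2) * sin (2 * (1 / 2) * x)) 0 r)
    <= (1 / 2 - 0) * exp (1 / 4 - r ^ 2)).
{ apply (norm_RInt_le_const (V := R_NormedModule)) with (3 := H); [lra |].
  intros u Hu; change norm with Rabs; cbv beta.
  rewrite Rabs_mult, (Rabs_pos_eq (exp _)) by (apply Rlt_le, exp_pos).
  rewrite <- (Rmult_1_r (exp (1 / 4 - _))).
  apply Rmult_le_compat; [apply Rlt_le, exp_pos | apply Rabs_pos | |].
  - assert (Hu2 : u ^ 2 - r ^ 2 <= 1 / 4 - r ^ 2) by nra.
    destruct (Rle_lt_or_eq_dec _ _ Hu2) as [Hlt | ->]; [| lra].
    apply Rlt_le, exp_increasing, Hlt.
  - apply Rabs_le, COS_bound. }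
apply Rle_trans with (exp (- (1 / 4)) * ((1 / 2 - 0) * exp (1 / 4 - r ^ 2))).
{ apply Rmult_le_compat_l; [apply Rlt_le, exp_pos | exact Hb]. }
replace (- r ^ 2) with (- (1 / 4) + (1 / 4 - r ^ 2)) by ring.
rewrite exp_plus; lra.
Qed.

(** The crude bound [exp (r ^ 2) >= 1 + r ^ 2 >= 2 * r] already beats [/ eps / 2]. *)
Lemma exp_opp_sqr_lt (eps r : R) : 0 < eps -> / eps < r -> exp (- r ^ 2) / 2 < eps.
Proof.
intros Heps Hr.
assert (Hi := Rinv_0_lt_compat _ Heps).
assert (He := exp_ineq1_le (r ^ 2)).
rewrite exp_Ropp.
apply Rlt_le_trans with (/ / eps); [| rewrite Rinv_inv; lra].
assert (Hinv : / exp (r ^ 2) < / (/ eps / 2)).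
{ apply Rinv_0_lt_contravar; nra. }
rewrite Rinv_div in Hinv; unfold Rdiv in Hinv; lra.
Qed.

Theorem theorem4p4 :
  is_RInt_gen (fun x : R => exp (- x ^ 2) * sin x)
    (at_point 0) (Rbar_locally p_infty)
    (sqrt PI / 2 * exp (- (1 / 4)) * erfi (1 / 2)).
Proof.
replace (sqrt PI / 2 * exp (- (1 / 4)) * erfi (1 / 2))
  with (exp (- (1 / 4)) * RInt (fun t => exp (t ^ 2)) 0 (1 / 2)).
2: { unfold erfi; field; apply Rgt_not_eq, sqrt_lt_R0, PI_RGT_0. }
intros P [eps HP].
(* The lower limit is exactly 0, and the cutoff [/ eps] is the one that makes the truncation error
   smaller than [eps]. *)
apply (Filter_prod _ _ _ (fun a => a = 0) (fun r => / eps < r)).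
- reflexivity.
- exists (/ eps); auto.
- intros a r -> Hr.
  eexists; split; [apply is_RInt_gauss_sin_1 |].
  apply HP.
  apply Rle_lt_trans with (1 := gauss_sin_truncation_error r).
  apply exp_opp_sqr_lt; [apply cond_pos | exact Hr].
Qed.
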